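(* Let $d\ge2$ and let $P=[p_{xy}]$ be the $n\times n$ irreducible stochastic transition matrix of a periodic Markov chain, of the block-cyclic form described as follows: $P$ is a $d\times d$ block matrix whose diagonal blocks are square of sizes $n_1,\dots,n_d$ (so $n=n_1+\cdots+n_d$), the block in position $(i+1,i)$ is a stochastic matrix $A_i$ of size $n_{i+1}\times n_i$ for $1\le i\le d-1$, the block in position $(1,d)$ is a stochastic matrix $A_d$ of size $n_1\times n_d$, and all other blocks are zero. Suppose $n_1\le n_i$ for $1\le i\le d$. Then $$\kappa(P)\ge n-\frac{dn_1+1}{2}.$$ Equality holds when $P$ is given as follows: for each $j=1,\dots,d$, the set of states of the $j$-th diagonal block is partitioned into $n_1$ nonempty subsets $C_1^j,\dots,C_{n_1}^j$, and $$p_{xy}=\begin{cases}\frac{1}{|C_\ell^d|},&\text{if }x\in C_\ell^1\text{ and }y\in C_\ell^d\text{ for some }1\le\ell\le n_1;\\[2pt]\frac{1}{|C_\ell^{j-1}|},&\text{if }x\in C_\ell^j\text{ and }y\in C_\ell^{j-1}\text{ for some }1\le\ell\le n_1,\ 3\le j\le d;\\[2pt]1,&\text{if }x\in C_\ell^2\text{ and }y\in C_{\ell-1}^1\text{ for some }2\le\ell\le n_1,\text{ or }x\in C_1^2\text{ and }y\in C_{n_1}^1;\\0,&\text{otherwise.}\end{cases}$$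
   Context: A (possibly rectangular) nonnegative matrix $A$ is stochastic if $A\mathbf{1}=\mathbf{1}$, where $\mathbf{1}$ is the all-ones vector of appropriate size. The period of state $i$ of a chain with transition matrix $P$ is the gcd of all $k\ge1$ with $(P^k)_{ii}>0$; the chain is periodic if all periods are at least 2. Kemeny's constant of an irreducible stochastic $N\times N$ matrix $Q$ with eigenvalues $\lambda_1=1,\lambda_2,\dots,\lambda_N$ (with algebraic multiplicity) is $\kappa(Q)=\sum_{i=2}^N\frac{1}{1-\lambda_i}$; equivalently $\kappa(Q)=\operatorname{Tr}\big((I-Q+\mathbf{1}\mathbf{h}^T)^{-1}\big)-1$ for any $\mathbf{h}$ with $\mathbf{h}^T\mathbf{1}=1$. *)

(* Defs.v *)
From HB Require Import structures.
From mathcomp Require Import all_boot all_order all_algebra.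
From mathcomp Require Import complex reals.
Set Implicit Arguments.
Unset Strict Implicit.
Unset Printing Implicit Defensive.

Import Order.TTheory GRing.Theory Num.Theory.
Local Open Scope ring_scope.

Definition stochastic (R : realType) (m n : nat) (A : 'M[R]_(m, n)) : Prop :=
  (forall i j, 0 <= A i j) /\
  A *m const_mx 1 = const_mx 1 :> 'cV[R]_m.

Definition irreducible (R : realType) (n : nat) (P : 'M[R]_n) : Prop :=
  forall i j, exists k : nat, 0 < (P ^+ k) i j.

(* g is the gcd of the possibly infinite set of all k >= 1 with
   (P ^+ k) i i > 0: its divisors are the common divisors of that set. *)
Definition is_period (R : realType) (n : nat) (P : 'M[R]_n) (i : 'I_n)
    (g : nat) : Prop :=
  forall e : nat,
    (e %| g)%N <-> (forall k, (0 < k)%N -> 0 < (P ^+ k) i i -> (e %| k)%N).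

Definition periodic (R : realType) (n : nat) (P : 'M[R]_n) : Prop :=
  forall i, exists2 g, is_period P i g & (2 <= g)%N.

(* The complex roots of the (monic) characteristic polynomial, listed with
   algebraic multiplicity. *)
Definition eigenvalues (R : realType) (n : nat) (Q : 'M[R]_n) : seq R[i] :=
  sval (closed_field_poly_normal (char_poly (map_mx (real_complex R) Q))).

(* [rem] drops a single occurrence of the eigenvalue 1.  The value lives in
   R[i], whose order satisfies u <= v iff Re u <= Re v and Im u = Im v. *)
Definition kemeny (R : realType) (n : nat) (Q : 'M[R]_n) : R[i] :=
  \sum_(z <- rem 1 (eigenvalues Q)) (1 - z)^-1.

(* Blocks are indexed by 'I_d, from 0; [ordS] and [ord_pred] are the cyclic
   successor and predecessor, so that [ord_pred (block1 hd)] is the last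
   block. *)
Definition block1 (d : nat) (hd : (2 <= d)%N) : 'I_d := Ordinal (ltnW hd).

Definition block_cyclic (R : realType) (d : nat) (s : 'I_d -> nat)
    (P : 'M[R]_(\sum_i s i)) : Prop :=
  forall i j : 'I_d,
    if i == ordS j then stochastic (submxblock P i j)
    else submxblock P i j = 0.

Definition block_states (d : nat) (s : 'I_d -> nat) (j : 'I_d) :
    {set 'I_(\sum_i s i)} :=
  [set x | tagnat.sig1 x == j].

(* Injectivity makes the r sets C j 0, ..., C j (r - 1) pairwise distinct;
   [partition] then makes them nonempty and pairwise disjoint. *)
Definition block_partitions (d : nat) (s : 'I_d -> nat) (r : nat)
    (C : 'I_d -> 'I_r -> {set 'I_(\sum_i s i)}) : Prop :=
  forall j : 'I_d,
    injective (C j) /\ partition [set C j l | l : 'I_r] (block_states s j).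

(* Since indices start at 0, the second clause (blocks 3, ..., d) reads
   2 <= j, and [ord_pred l] is l - 1, or the last index when l is the first. *)
Definition extremal_form (R : realType) (d : nat) (hd : (2 <= d)%N)
    (s : 'I_d -> nat) (r : nat) (C : 'I_d -> 'I_r -> {set 'I_(\sum_i s i)})
    (P : 'M[R]_(\sum_i s i)) : Prop :=
  let b1 := block1 hd in
  let b2 := ordS b1 in
  let bd := ord_pred b1 in
  let case1 x y l := (x \in C b1 l) && (y \in C bd l) in
  let case2 x y (j : 'I_d) l :=
    [&& (2 <= j)%N, x \in C j l & y \in C (ord_pred j) l] in
  let case3 x y l := (x \in C b2 l) && (y \in C b1 (ord_pred l)) in
  forall x y,
  [/\ forall l, case1 x y l -> P x y = (#|C bd l|%:R)^-1,
      forall j l, case2 x y j l -> P x y = (#|C (ord_pred j) l|%:R)^-1,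
      forall l, case3 x y l -> P x y = 1
    & (forall l, ~~ case1 x y l) -> (forall j l, ~~ case2 x y j l) ->
      (forall l, ~~ case3 x y l) -> P x y = 0].

(* Main.v *)
(* On the closed unit disc minus 1 one has Re (1 / (1 - z)) >= 1/2, with
   equality exactly on the unit circle, while z = 0 contributes 1. All
   eigenvalues of P lie in the disc and, by the maximum principle, 1 is a
   simple one, so kappa(P), which is real because P is, is at least (n - 1 + k)
   / 2, where k is the multiplicity of the eigenvalue 0. In the Leibniz
   expansion of the characteristic polynomial, a nonzero term comes from a
   permutation whose nonfixed points are spread evenly over the d blocks, hence
   number at most d n_1; so k >= n - d n_1. In the extremal case P averages
   over the cells of a cycle of m = d n_1 cells, so all m-th roots of unity are
   eigenvalues and every inequality is an equality. *)

Require Import Defs.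
From HB Require Import structures.
From mathcomp Require Import all_boot all_order all_algebra.
From mathcomp Require Import perm cyclotomic separable zify ring lra.
From mathcomp Require Import complex reals.
Import Order.TTheory GRing.Theory Num.Theory.
Local Open Scope ring_scope.

Set Implicit Arguments.
Unset Strict Implicit.
Unset Printing Implicit Defensive.

(** * Stochastic matrices, the maximum principle and simplicity of the eigenvalue 1 *)

Lemma stochastic_sum (R : realType) (m n : nat) (A : 'M[R]_(m, n)) i :
  stochastic A -> \sum_j A i j = 1.
Proof.
move=> [_ /matrixP/(_ i 0)]; rewrite !mxE => <-.
by apply: eq_bigr => j _; rewrite mxE mulr1.
Qed.

Lemma stochasticX (R : realType) (n : nat) (P : 'M[R]_n) k :
  stochastic P -> stochastic (P ^+ k).
Proof.
move=> [P0 P1]; elim: k => [|k [Pk0 Pk1]].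
  by rewrite expr0; split=> [i j|]; [rewrite mxE ler0n | rewrite mul1mx].
rewrite exprS; split=> [i j|]; last by rewrite -mulmxA Pk1.
by rewrite mxE sumr_ge0 // => l _; rewrite mulr_ge0.
Qed.

Lemma stochastic_max (R : realType) (n : nat) (P : 'M[R]_n) (w : 'cV[R]_n) i0 :
  stochastic P -> (forall j, w j 0 <= w i0 0) -> (P *m w) i0 0 <= w i0 0.
Proof.
move=> sP wmax; rewrite mxE -[leRHS]mul1r -(stochastic_sum i0 sP) mulr_suml.
by apply: ler_sum => j _; rewrite ler_wpM2l //; case: sP => P0 _; apply: P0.
Qed.

(** At a maximum [m] of [w], the nonnegative gaps [w m 0 - w l' 0] have weighted sum zero under row
    [m] of every power of [P]. Irreducibility gives any chosen [l] a positive weight in some power,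
    so its gap vanishes. *)
Lemma harmonic_const (R : realType) (n : nat) (P : 'M[R]_n) (w : 'cV[R]_n) i j :
  stochastic P -> irreducible P -> P *m w = w -> w i 0 = w j 0.
Proof.
move=> sP iP Pw.
have [m _ mmax] := @arg_maxP _ _ _ i xpredT (fun i => w i 0) isT.
have Pwk k : P ^+ k *m w = w.
  by elim: k => [|k IHk]; rewrite ?expr0 ?mul1mx // exprS -mulmxA IHk.
suff wm l : w l 0 = w m 0 by rewrite !wm.
have [k Pk] := iP m l; have sPk := stochasticX k sP.
have /eqP : \sum_l' (P ^+ k) m l' * (w m 0 - w l' 0) = 0.
  under eq_bigr do rewrite mulrBr.
  rewrite sumrB -mulr_suml stochastic_sum // mul1r.
  by have /matrixP/(_ m 0) := Pwk k; rewrite mxE => ->; rewrite subrr.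
rewrite psumr_eq0 => [/allP/(_ l)|l' _]; last first.
  by apply: mulr_ge0; [case: sPk => Hk _; apply: Hk | rewrite subr_ge0; apply: mmax].
rewrite mem_index_enum mulf_eq0 (gt_eqF Pk) subr_eq0 => /(_ isT)/eqP -> //.
Qed.

(** Evaluating at a maximum of [w] gives [c <= 0]; evaluating at a minimum gives the reverse. This
    rules out a Jordan block of size 2 or more at the eigenvalue 1. *)
Lemma harmonic_shift (R : realType) (n : nat) (P : 'M[R]_n) (w : 'cV[R]_n) c :
  (0 < n)%N -> stochastic P -> P *m w = w + const_mx c -> c = 0.
Proof.
move=> n0 sP Pw; apply: le_anti; apply/andP; split.
  have [m _ mmax] :=
    @arg_maxP _ _ _ (Ordinal n0) xpredT (fun i => w i 0) isT.
  have := @stochastic_max _ _ P w m sP (fun j => mmax j isT).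
  by rewrite Pw !mxE gerDl.
have [m _ mmin] := @arg_minP _ _ _ (Ordinal n0) xpredT (fun i => w i 0) isT.
have := @stochastic_max _ _ P (- w) m sP.
rewrite mulmxN Pw !mxE lerN2 lerDl; apply => j.
by rewrite !mxE lerN2; apply: mmin.
Qed.

(** [D.[1]] is the determinant of I - P with its first column replaced by ones. A kernel vector [v]
    of that matrix, with its first entry set to zero, is a [w] with P w = w + c 1, where c is the
    deleted entry. Then c = 0 by [harmonic_shift], and [w] is constant, hence zero. *)
Lemma char_poly_simple_root1 (R : realType) (n : nat) (P : 'M[R]_n) :
  (0 < n)%N -> stochastic P -> irreducible P ->
  exists2 D : {poly R}, char_poly P = ('X - 1) * D & D.[1] != 0.
Proof.
move=> n0 sP iP; pose o := Ordinal n0.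
pose E : 'M[{poly R}]_n :=
  \matrix_(i, j) if j == o then 1 else (i == j)%:R.
pose F : 'rV[{poly R}]_n := \row_j if j == o then 'X - 1 else 1.
pose M : 'M[{poly R}]_n :=
  \matrix_(i, j) if j == o then 1 else char_poly_mx P i j.
(* Adding all columns of X - P to column 0 turns it into X - 1 times the
   all-ones column. *)
have PEMF : char_poly_mx P *m E = M *m diag_mx F.
  apply/matrixP => i j; rewrite mul_mx_diag !mxE.
  case: (eqVneq j o) => [->|jo].
    under eq_bigr do rewrite !mxE eqxx mulr1.
    rewrite sumrB -rmorph_sum /= stochastic_sum // mul1r.
    by rewrite (bigD1 i) //= eqxx mulr1n big1 ?addr0 // => k /negPf;
       rewrite eq_sym => ->.
  rewrite mulr1 (bigD1 j) //= big1 => [|k /negPf kj]; last first.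
    by rewrite !mxE (negPf jo) kj mulr0.
  by rewrite !mxE (negPf jo) eqxx mulr1 addr0.
have dE : \det E = 1.
  rewrite det_trig; last first.
    apply/is_trig_mxP => i j ij; rewrite mxE; case: eqP => [jo|_].
      by move: ij; rewrite jo.
    by rewrite -val_eqE (ltn_eqF ij).
  by apply: big1 => i _; rewrite mxE eqxx; case: ifP.
exists (\det M).
  have := congr1 determinant PEMF; rewrite !det_mulmx dE mulr1 mulrC det_diag.
  rewrite (bigD1 o) //= big1 => [|j /negPf jo]; last by rewrite mxE jo.
  by rewrite mxE eqxx mulr1 /char_poly => ->; rewrite mulrC.
rewrite -horner_evalE -det_map_mx -det_tr; apply/det0P => -[v v0 vN].
pose w : 'cV[R]_n := \col_j if j == o then 0 else v 0 j.
have Pw : P *m w = w + const_mx (v 0 o).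
  apply/matrixP => i k; rewrite !mxE.
  move/matrixP/(_ 0 i): vN; rewrite !mxE (bigD1 o) //= !mxE eqxx /=.
  rewrite horner_evalE hornerE mulr1.
  under eq_bigr => j jo do rewrite !mxE (negPf jo) horner_evalE hornerE
    hornerMn hornerX hornerN hornerC mulrBr.
  rewrite sumrB addrA => /eqP; rewrite subr_eq0 addrC => /eqP vi.
  rewrite (bigD1 o) //= mxE eqxx mulr0 add0r.
  under eq_bigr => j jo do rewrite mxE (negPf jo) mulrC.
  rewrite -vi; congr (_ + _).
  case: (eqVneq i o) => [->|io].
    by rewrite big1 // => j; rewrite eq_sym => /negPf ->; rewrite mulr0n mulr0.
  rewrite (bigD1 i) //= eqxx mulr1 big1 ?addr0 // => j /andP[_].
  by rewrite eq_sym => /negPf ->; rewrite mulr0.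
have vo : v 0 o = 0 := harmonic_shift n0 sP Pw.
have Pw' : P *m w = w by rewrite Pw vo; apply/matrixP => i j; rewrite !mxE addr0.
case/negP: v0; apply/eqP/matrixP => i j; rewrite ord1 !mxE.
have := harmonic_const j o sP iP Pw'; rewrite !mxE eqxx.
by case: eqVneq => [-> _|].
Qed.

(** * Cyclic support and the power of X dividing the characteristic polynomial *)

Lemma ordS_neq (d : nat) (j : 'I_d) : (2 <= d)%N -> ordS j != j.
Proof.
case: j => j jd d2; rewrite -val_eqE /=; move: jd; rewrite leq_eqVlt.
case/orP => [/eqP jd|jd]; last by rewrite modn_small // gtn_eqF.
by rewrite jd modnn; case: j jd d2 => // <-.
Qed.

Lemma leq_block1 (d : nat) (hd : (2 <= d)%N) (u : 'I_d -> nat) :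
  (forall j, j != block1 hd -> u j <= u (ord_pred j))%N ->
  forall j, (u j <= u (block1 hd))%N.
Proof.
move=> mono [j jd]; elim: j jd => [|j IHj] jd.
  by rewrite (_ : Ordinal jd = block1 hd) //; apply: val_inj.
apply: leq_trans (mono _ _) _ => //.
have jd' := ltnW jd; rewrite (_ : ord_pred _ = Ordinal jd') //.
by apply: val_inj; rewrite /= modnDr modn_small.
Qed.

Section CyclicSupport.
Variables (F : fieldType) (d n : nat) (hd : (2 <= d)%N).
Variables (b : 'I_n -> 'I_d) (P : 'M[F]_n).
Hypothesis P_cyclic : forall x y, P x y != 0 -> b x = ordS (b y).

(** The permutation injects the nonfixed points of each block into those of the preceding block.
    Following this back to block 1, no block has more nonfixed points than block 1 has states. *)
Lemma card_cyclic_support (s : 'S_n) :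
  (forall x, s x != x -> P x (s x) != 0) ->
  (#|[set x | s x != x]| <= d * #|[set x | b x == block1 hd]|)%N.
Proof.
move=> sP; pose U j := [set x | (s x != x) && (b x == j)].
have U_mono j : (#|U j| <= #|U (ord_pred j)|)%N.
  rewrite -(card_imset _ (@perm_inj _ s)); apply: subset_leq_card.
  apply/subsetP => y /imsetP[x]; rewrite inE => /andP[sx /eqP <-] ->.
  by rewrite inE (inj_eq perm_inj) sx (P_cyclic (sP x sx)) ordSK eqxx.
rewrite -sum1_card (partition_big b predT) //=.
rewrite -[X in (X * _)%N]card_ord -sum_nat_const; apply: leq_sum => j _.
apply: (@leq_trans #|U j|).
  by rewrite -sum1_card; apply: eq_leq; apply: eq_bigl => x; rewrite !inE.
apply: leq_trans (leq_block1 (u := fun j => #|U j|) (fun j _ => U_mono j) j) _.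
by apply: subset_leq_card; apply/subsetP => x; rewrite !inE => /andP[].
Qed.

Lemma dvdp_char_poly_cyclic :
  'X^(n - d * #|[set x | b x == block1 hd]|) %| char_poly P.
Proof.
rewrite /char_poly /determinant.
apply: (big_ind (fun p => _ %| p)) => [|p q|s _]; rewrite ?dvdp0 //.
  exact: dvdp_add.
apply: dvdp_mull.
(* Either some nonfixed point contributes a zero factor and the Leibniz term vanishes, or
   [card_cyclic_support] applies. In the latter case each fixed point contributes a factor X, since
   the diagonal of [P] is zero. *)
have [/existsP[x /andP[sx /eqP P0]]|/existsPn sP] :=
  boolP [exists x, (s x != x) && (P x (s x) == 0)].
  by rewrite (bigD1 x) //= !mxE eq_sym (negPf sx) P0 subrr mul0r dvdp0.
have Pxx x : P x x = 0.
  by apply: contraTeq (ordS_neq (b x) hd) => /P_cyclic <-; rewrite eqxx.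
rewrite (bigID (fun x => s x == x)) /=; apply: dvdp_mulr.
rewrite (eq_bigr (fun=> 'X)) => [|x /eqP sx]; last first.
  by rewrite !mxE sx eqxx Pxx subr0.
rewrite prodr_const; apply: dvdp_exp2l.
rewrite leq_subLR addnC -(leq_add2l #|[set x | s x != x]|).
have -> : (#|[set x | s x != x]| + n =
     #|[set x | s x != x]| + (#|[pred x | s x == x]| + #|[set x | s x != x]|))%N.
  congr (_ + _)%N; rewrite -[LHS](card_ord n) -(cardC [pred x | s x == x]).
  by congr (_ + _)%N; apply: eq_card => x; rewrite !inE.
rewrite leq_add2l leq_add2l.
apply: card_cyclic_support => x sx; move: (sP x); rewrite sx /=; exact.
Qed.

End CyclicSupport.

(** * Eigenvalues with multiplicity and their bound by 1 *)

Section Eigenvalues.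
Variables (R : realType) (n : nat) (P : 'M[R]_n).
Local Notation L := (eigenvalues P).

Lemma prod_eigenvalues :
  \prod_(z <- L) ('X - z%:P) = map_poly (real_complex R) (char_poly P).
Proof.
rewrite map_char_poly /eigenvalues; case: closed_field_poly_normal => /= s ->.
by rewrite (monicP (char_poly_monic _)) scale1r.
Qed.

Lemma size_eigenvalues : size L = n.
Proof.
have := congr1 (fun p : {poly R[i]} => size p) prod_eigenvalues.
by rewrite size_prod_XsubC size_map_poly size_char_poly => -[].
Qed.

Lemma mem_eigenvalues z :
  (z \in L) = eigenvalue (map_mx (real_complex R) P) z.
Proof.
by rewrite eigenvalue_root_char -map_char_poly -prod_eigenvalues
           root_prod_XsubC.
Qed.

Lemma count_eigenvalues0 k :
  'X^k %| char_poly P -> (k <= count_mem 0%R L)%N.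
Proof.
rewrite -(dvdp_map (real_complex R)) -prod_eigenvalues map_polyXn => dvd.
rewrite -mu_prod_XsubC mup_geq ?subr0 //.
by rewrite -size_poly_eq0 size_prod_XsubC.
Qed.

(** Multiplying a row vector by a stochastic matrix does not increase its l1 norm; this is applied
    to a left eigenvector. *)
Lemma eigenvalue_norm_le1 z : stochastic P -> z \in L -> `|z| <= 1.
Proof.
move=> sP; rewrite mem_eigenvalues => /eigenvalueP[v vP v0].
have v_gt0 : 0 < \sum_j `|v 0 j|.
  rewrite lt_def sumr_ge0 // andbT; apply: contra_neq v0 => /eqP.
  rewrite psumr_eq0 // => /allP v0; apply/matrixP => i j; rewrite ord1 mxE.
  by apply/eqP; rewrite -normr_eq0; apply: v0; rewrite mem_index_enum.
rewrite -(ler_pM2r v_gt0) mul1r mulr_sumr.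
apply: (@le_trans _ _ (\sum_j \sum_i `|v 0 i| * (P i j)%:C%C)).
  apply: ler_sum => j _; rewrite -normrM.
  move/matrixP/(_ 0 j): vP; rewrite !mxE => <-.
  apply: le_trans (ler_norm_sum _ _ _) _; apply: ler_sum => i _.
  rewrite !mxE normrM ler_wpM2l // ger0_norm // ler0c.
  by case: sP => P0 _; apply: P0.
rewrite exchange_big /=; apply: ler_sum => i _.
by rewrite -mulr_sumr -rmorph_sum /= stochastic_sum // mulr1.
Qed.

Lemma rem1_eigenvalues (D : {poly R}) :
  char_poly P = ('X - 1) * D -> perm_eq L (1 :: rem 1 L).
Proof.
move=> PD; apply: perm_to_rem; rewrite -root_prod_XsubC prod_eigenvalues PD.
by rewrite rmorphM rmorphB /= rmorph1 map_polyX rootM -polyC1 root_XsubC eqxx.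
Qed.

End Eigenvalues.

(** * Kemeny's constant as a sum of real parts *)

Lemma sum_inv_XsubC (F : fieldType) (s : seq F) (x : F) : x \notin s ->
  \sum_(z <- s) (x - z)^-1 =
  (\prod_(z <- s) ('X - z%:P))^`().[x] / (\prod_(z <- s) ('X - z%:P)).[x].
Proof.
elim: s => [|z s IHs]; first by rewrite !big_nil derivC horner0 mul0r.
rewrite inE negb_or => /andP[xz xs]; rewrite !big_cons IHs // derivM derivXsubC.
rewrite mul1r !hornerE.
have z0 : x - z != 0 by rewrite subr_eq0.
have s0 : (\prod_(j <- s) ('X - j%:P)).[x] != 0.
  by rewrite -rootE root_prod_XsubC.
by field; rewrite s0 z0.
Qed.

Section Kemeny.
Variables (R : realType) (n : nat) (P : 'M[R]_n).
Hypotheses (n_gt0 : (0 < n)%N) (sP : stochastic P) (iP : irreducible P).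
Local Notation L := (eigenvalues P).
Local Notation Re := (@complex.Re R).

Lemma kemeny_rem1 :
  [/\ perm_eq L (1 :: rem 1 L), 1 \notin rem 1 L &
      kemeny P = (\sum_(z <- rem 1 L) Re (1 - z)^-1)%:C%C].
Proof.
have [D PD D1] := char_poly_simple_root1 n_gt0 sP iP.
have LL := rem1_eigenvalues PD.
have prodD : \prod_(z <- rem 1 L) ('X - z%:P) = map_poly (real_complex R) D.
  apply: (mulfI (monic_neq0 (monicXsubC (1 : R[i])))).
  have := prod_eigenvalues P.
  rewrite (perm_big _ LL) big_cons PD rmorphM rmorphB /= map_polyX.
  by rewrite -!polyC1 map_polyC /= => ->.
have rem1 : 1 \notin rem 1 L.
  rewrite -root_prod_XsubC prodD -(rmorph1 (real_complex R)).
  by rewrite fmorph_root.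
(* The sum is the logarithmic derivative at 1 of the product over the remaining eigenvalues. That
   product is the real polynomial [D], so the value is real and may be computed from real parts. *)
have K : kemeny P = (D^`().[1] / D.[1])%:C%C.
  rewrite /kemeny sum_inv_XsubC // prodD deriv_map -[1](rmorph1 (real_complex R)).
  by rewrite !horner_map /= fmorph_div.
split=> //; suff <- : Re (kemeny P) = \sum_(z <- rem 1 L) Re (1 - z)^-1.
  by rewrite K.
by rewrite /kemeny; apply: (big_morph Re) => // -[? ?] [? ?].
Qed.

(** The summand is the termwise lower bound for Re (1 / (1 - z)): 1 at zero and 1/2 elsewhere. *)
Lemma sum_half (s : seq R[i]) :
  \sum_(z <- s) (1 + (z == 0)%:R) / 2 = (size s + count_mem 0%R s)%:R / 2 :> R.
Proof.
rewrite -mulr_suml; congr (_ / _); elim: s => [|z s IHs]; rewrite ?big_nil //.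
by rewrite big_cons IHs /= !natrD -[(size s).+1]addn1 natrD; ring.
Qed.

Lemma size_rem1 : (size (rem 1 L)).+1 = n.
Proof.
have [LL _ _] := kemeny_rem1.
by rewrite -[RHS](size_eigenvalues P) (perm_size LL).
Qed.

Lemma count0_rem1 : count_mem 0%R (rem 1 L) = count_mem 0%R L.
Proof.
have [LL _ _] := kemeny_rem1.
by rewrite ((seq.permP LL) (pred1 0)) /= oner_eq0 add0n.
Qed.

End Kemeny.

(** * The real part of 1 / (1 - z) on the unit disc *)

Section HalfPlane.
Variable R : realType.
Local Notation Re := (@complex.Re R).

Lemma sub1_sqnorm_gt0 (z : R[i]) :
  z != 1 -> 0 < (1 - Re z) ^+ 2 + complex.Im z ^+ 2.
Proof.
case: z => a b; rewrite eq_complex /= lt_def addr_ge0 ?sqr_ge0 // andbT.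
by apply: contra; rewrite paddr_eq0 ?sqr_ge0 // !sqrf_eq0 subr_eq0 eq_sym.
Qed.

(** This is Re (1 / (1 - z)) - 1/2 = (1 - |z|^2) / (2 |1 - z|^2) with the denominator cleared; the
    inequality and its equality case are both read off from it. *)
Lemma Re_inv_sub1 (z : R[i]) : z != 1 ->
  (Re (1 - z)^-1 - 2^-1) * (2 * ((1 - Re z) ^+ 2 + complex.Im z ^+ 2)) =
  1 - (Re z ^+ 2 + complex.Im z ^+ 2).
Proof.
move=> /sub1_sqnorm_gt0; case: z => a b /= /lt0r_neq0 z1.
by rewrite sub0r sqrrN; field.
Qed.

Lemma Re_inv_sub1_ge (z : R[i]) : z != 1 -> `|z| <= 1 ->
  (1 + (z == 0)%:R) / 2 <= Re (1 - z)^-1.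
Proof.
case: (eqVneq z 0) => [->|z0] z1 zle.
  by rewrite subr0 invr1 /=; lra.
have S_gt0 : 0 < 2 * ((1 - Re z) ^+ 2 + complex.Im z ^+ 2).
  by rewrite mulr_gt0 ?sub1_sqnorm_gt0.
rewrite addr0 mul1r -subr_ge0 -(pmulr_lge0 _ S_gt0) Re_inv_sub1 // subr_ge0.
by rewrite -lecR add_Re2_Im2 rmorph1 -(expr1n _ 2) lerXn2r // nnegrE.
Qed.

Lemma Re_inv_sub1_eq (z : R[i]) : z != 1 -> `|z| = 1 -> Re (1 - z)^-1 = 2^-1.
Proof.
move=> z1 zE; have := Re_inv_sub1 z1.
have -> : Re z ^+ 2 + complex.Im z ^+ 2 = 1.
  by apply: (@complexI R); rewrite add_Re2_Im2 rmorph1 zE expr1n.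
have := sub1_sqnorm_gt0 z1.
move=> h /eqP; rewrite subrr mulf_eq0 subr_eq0 mulf_eq0 (gt_eqF h).
by rewrite pnatr_eq0 !orbF => /eqP.
Qed.

End HalfPlane.

(** * The bound through the multiplicity of the eigenvalue 0, and its equality case *)

Section KemenyBound.
Variables (R : realType) (n : nat) (P : 'M[R]_n).
Hypotheses (n_gt0 : (0 < n)%N) (sP : stochastic P) (iP : irreducible P).
Local Notation L := (eigenvalues P).

(** The n - 1 remaining eigenvalues account for (n - 1) / 2, written as n - (n + 1) / 2 to resemble
    the final bound. *)
Lemma size_count0_half :
  (size (rem 1 L) + count_mem 0%R (rem 1 L))%:R / 2 =
  n%:R - (n + 1)%:R / 2 + (count_mem 0%R L)%:R / 2 :> R.
Proof.
have /(congr1 (fun k => k%:R : R)) := size_rem1 n_gt0 sP iP.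
by rewrite count0_rem1 // !natrD -natr1 => <-; field.
Qed.

Lemma kemeny_ge :
  (n%:R - (n + 1)%:R / 2 + (count_mem 0%R L)%:R / 2)%:C%C <= kemeny P.
Proof.
have [LL L1 ->] := kemeny_rem1 n_gt0 sP iP.
rewrite lecR -size_count0_half -sum_half big_seq [leRHS]big_seq.
apply: ler_sum => z zL; apply: Re_inv_sub1_ge.
  by apply: contraTneq zL => ->.
by apply: (eigenvalue_norm_le1 sP); apply: mem_rem zL.
Qed.

Lemma kemeny_eq : (forall z, z \in L -> z = 0 \/ `|z| = 1) ->
  kemeny P = (n%:R - (n + 1)%:R / 2 + (count_mem 0%R L)%:R / 2)%:C%C.
Proof.
move=> L01; have [LL L1 ->] := kemeny_rem1 n_gt0 sP iP.
rewrite -size_count0_half -sum_half big_seq [in RHS]big_seq; congr (_%:C%C).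
apply: eq_bigr => z zL; have z1 : z != 1 by apply: contraTneq zL => ->.
have [->|zE] := L01 z (mem_rem zL).
  by rewrite eqxx subr0 invr1 /=; field.
have /negPf-> : z != 0 by rewrite -normr_eq0 zE oner_eq0.
by rewrite Re_inv_sub1_eq // addr0 mul1r.
Qed.

End KemenyBound.

(** * The chain that averages over a cycle of cells *)

Lemma val_iter_ordS (m k : nat) (u : 'I_m) :
  iter k (@ordS m) u = ((u + k) %% m)%N :> nat.
Proof.
elim: k => [|k IHk]; first by rewrite addn0 modn_small.
by rewrite iterS /= IHk -addn1 modnDml addn1 addnS.
Qed.

Section CyclicAverage.
Variables (n m : nat) (c : 'I_n -> 'I_m).
Hypothesis c_surj : forall u, exists x, c x = u.

Definition fiber u := [set x | c x == u].

(** From [x] the chain jumps to a uniformly random state of the cell before that of [x]. The field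
    is a parameter so that the same matrix can be studied over R and over its complex extension. *)
Definition cyclic_average (F : fieldType) : 'M[F]_n :=
  \matrix_(x, y) if c x == ordS (c y) then #|fiber (c y)|%:R^-1 else 0.

Lemma map_cyclic_average (F G : fieldType) (f : {rmorphism F -> G}) :
  map_mx f (cyclic_average F) = cyclic_average G.
Proof.
apply/matrixP => x y; rewrite !mxE (fun_if f) rmorph0 fmorphV rmorph_nat //.
Qed.

Lemma fiber_gt0 u : (0 < #|fiber u|)%N.
Proof. by apply/card_gt0P; have [x <-] := c_surj u; exists x; rewrite inE. Qed.

Variable F : numFieldType.
Local Notation A := (cyclic_average F).

Lemma fiber_neq0 u : #|fiber u|%:R != 0 :> F.
Proof. by rewrite pnatr_eq0 -lt0n fiber_gt0. Qed.

Lemma sum_fiber (g : 'I_m -> F) u :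
  \sum_(y | c y == u) g (c y) / #|fiber (c y)|%:R = g u.
Proof.
under eq_bigr => y /eqP -> do [].
rewrite sumr_const -[X in _ *+ X](_ : #|fiber u| = _); last first.
  by apply: eq_card => y; rewrite inE.
by rewrite -[LHS]mulr_natr mulfVK // fiber_neq0.
Qed.

(** On functions of the cell alone the matrix acts as a cyclic shift; its powers and row sums follow
    from this. *)
Lemma cyclic_average_mul (g : 'I_m -> F) x :
  \sum_y A x y * g (c y) = g (ord_pred (c x)).
Proof.
rewrite -[RHS]sum_fiber [RHS]big_mkcond /=; apply: eq_bigr => y _.
rewrite mxE [_ == ordS _]eq_sym (can2_eq (@ordSK m) (@ord_predK m)).
by case: ifP => _; rewrite ?mul0r // mulrC.
Qed.

(** The exponent starts at 1 because the zeroth power is the identity, not an average over a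
    cell. *)
Lemma cyclic_averageX k x y : (A ^+ k.+1) x y =
  if c x == iter k.+1 (@ordS m) (c y) then #|fiber (c y)|%:R^-1 else 0.
Proof.
elim: k x => [|k IHk] x; first by rewrite expr1 mxE.
rewrite exprS mxE; under eq_bigr do rewrite IHk.
rewrite (cyclic_average_mul (fun u => if u == _ then _ else _)).
by rewrite (can2_eq (@ord_predK m) (@ordSK m)).
Qed.

Lemma cyclic_averageX_gt0 k x y :
  (0 < (A ^+ k.+1) x y) = (c x == (c y + k.+1) %% m :> nat)%N.
Proof.
rewrite cyclic_averageX -(inj_eq (@ord_inj m)) val_iter_ordS.
case: ifP; rewrite ?ltxx //.
by rewrite invr_gt0 ltr0n fiber_gt0.
Qed.

Lemma eigenvalue_cyclic_average z : (0 < n)%N -> z ^+ m = 1 -> eigenvalue A z.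
Proof.
move=> n0 zm; apply/eigenvalueP.
(* This left eigenvector spreads the mass z^u evenly over cell u; the hypothesis [z ^+ m = 1] makes
   the weights match where the cycle closes. *)
exists (\row_x (z ^+ c x / #|fiber (c x)|%:R)).
  apply/matrixP => i y; rewrite !mxE.
  transitivity (z ^+ ordS (c y) / #|fiber (c y)|%:R).
    rewrite -(sum_fiber (fun u => z ^+ u)) mulr_suml [RHS]big_mkcond.
    by apply: eq_bigr => x _; rewrite !mxE; case: ifP; rewrite ?mulr0.
  by rewrite /= expr_mod // exprS mulrA.
apply/eqP => /matrixP/(_ 0 (Ordinal n0)) /eqP; rewrite !mxE mulf_eq0 invr_eq0.
rewrite (negPf (fiber_neq0 _)) orbF expf_eq0 => /andP[_ /eqP z0].
move: zm; rewrite z0 expr0n; case: m (c (Ordinal n0)) => [[]//|m' _] /= /eqP.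
by rewrite eq_sym oner_eq0.
Qed.

End CyclicAverage.

Section CyclicAverageChain.
Variables (R : realType) (n m : nat) (c : 'I_n -> 'I_m).
Hypothesis c_surj : forall u, exists x, c x = u.
Local Notation A := (cyclic_average c R).

Lemma cyclic_average_stochastic : stochastic A.
Proof.
split=> [x y|]; first by rewrite mxE; case: ifP; rewrite // invr_ge0 ler0n.
apply/matrixP => x i; rewrite !mxE -[RHS]/((fun=> 1) (ord_pred (c x))).
by rewrite -(cyclic_average_mul c_surj); apply: eq_bigr => y _; rewrite !mxE.
Qed.

Lemma cyclic_average_irreducible : irreducible A.
Proof.
(* This exponent is positive and congruent to [c x - c y] modulo [m], so it leads from [x] to the
   cell of [y]. *)
move=> x y; exists (c x + m + (m - c y))%N.
have cx := ltn_ord (c x); have cy := ltn_ord (c y).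
have -> : (c x + m + (m - c y) = (c x + m + (m - c y)).-1.+1)%N by lia.
rewrite cyclic_averageX_gt0 // prednK; last by lia.
have -> : (c y + (c x + m + (m - c y)) = c x + m + m)%N by lia.
by rewrite !modnDr modn_small.
Qed.

Lemma cyclic_average_periodic : (2 <= m)%N -> periodic A.
Proof.
move=> m2 x; exists m => // e.
have Ak k : (0 < k)%N -> (0 < (A ^+ k) x x) = (m %| k)%N.
  case: k => // k _; rewrite cyclic_averageX_gt0 // eq_sym.
  by rewrite -{2}(modn_small (ltn_ord (c x))) -{2}[val (c x)]addn0 eqn_modDl mod0n.
split=> [em k k0|]; first by rewrite Ak // => /(dvdn_trans em).
by apply; rewrite ?Ak // ltnW.
Qed.

(** The [m] distinct m-th roots of unity are nonzero eigenvalues, and the divisibility hypothesis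
    leaves room for at most [m] nonzero ones. Hence the spectrum is exactly these roots, each once,
    together with zeros, and [kemeny_eq] applies. *)
Lemma cyclic_average_kemeny : (0 < m)%N -> 'X^(n - m) %| char_poly A ->
  kemeny A = (n%:R - (m + 1)%:R / 2)%:C%C.
Proof.
move=> m0 Xdvd.
have n0 : (0 < n)%N by have [x _] := c_surj (Ordinal m0); case: n x => [[]|].
have [r rE] := closed_field_poly_normal ('X^m - 1 : {poly R[i]}).
rewrite (monicP (monicXnsubC _ m0)) scale1r in rE.
have r_uniq : uniq r.
  by rewrite -separable_prod_XsubC -rE separable_Xn_sub_1 // pnatr_eq0 -lt0n.
have r_size : size r = m.
  have := congr1 (fun p : {poly R[i]} => size p) rE.
  by rewrite size_prod_XsubC size_XnsubC // => -[].
have r_root z : z \in r -> z ^+ m = 1.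
  by rewrite -root_prod_XsubC -rE rootE !hornerE subr_eq0 => /eqP.
pose L := eigenvalues A; pose L' := [seq z <- L | z != 0].
have L'_size : (size L' + count_mem 0%R L = n)%N.
  by rewrite addnC size_filter count_predC size_eigenvalues.
have r_sub : {subset r <= L'}.
  move=> z /r_root zm; rewrite mem_filter mem_eigenvalues.
  rewrite map_cyclic_average eigenvalue_cyclic_average // andbT.
  apply: contra_eqN zm => /eqP ->; rewrite expr0n gtn_eqF //.
  by rewrite eq_sym oner_eq0.
have count0 := count_eigenvalues0 Xdvd.
have mL' : (m <= size L')%N by rewrite -r_size uniq_leq_size.
have L'm : (size L' <= m)%N.
  by move: L'_size count0; rewrite -/L; move: (size L') (count_mem _ L); lia.
(* [L'] lists nonzero eigenvalues with multiplicity, so equality of sizes also shows that no root of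
   unity is repeated. *)
have [|L'_r_size rL'] := uniq_min_size r_uniq r_sub; first by rewrite r_size.
rewrite kemeny_eq //; last first.
- move=> z zL; have [->|z0] := eqVneq z 0; [by left|right].
  have : z \in r by rewrite rL' mem_filter z0.
  move/r_root/(congr1 Num.norm); rewrite normrX normr1 => /eqP.
  by rewrite pexprn_eq1 // gtn_eqF //= => /eqP.
- exact: cyclic_average_irreducible.
- exact: cyclic_average_stochastic.
congr (_%:C%C); rewrite -/L.
move: (L'_size); rewrite -L'_r_size r_size => <-.
by rewrite !natrD; field.
Qed.

End CyclicAverageChain.

(** * From the block form to the cyclic support and back *)

Section Blocks.
Variables (R : realType) (d : nat) (hd : (2 <= d)%N) (s : 'I_d -> nat).
Local Notation n := (\sum_i s i)%N.
Local Notation b1 := (block1 hd).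
Implicit Types P : 'M[R]_n.

Lemma block_statesE j : block_states s j = [set tagnat.Rank j a | a : 'I_(s j)].
Proof.
apply/setP => x; rewrite inE; apply/eqP/imsetP => [<-|[a _ ->]].
  by exists (tagnat.sig2 x); rewrite ?tagnat.sig2K.
exact: tagnat.Rank1K.
Qed.

Lemma Rank_inj (j : 'I_d) : injective (@tagnat.Rank _ s j).
Proof.
move=> a a' /(congr1 (@nat_of_ord _)) /eqP.
by rewrite tagnat.eq_Rank eqxx => /eqP/val_inj.
Qed.

Lemma card_block_states j : #|block_states s j| = s j.
Proof. by rewrite block_statesE card_imset ?card_ord //; apply: Rank_inj. Qed.

Lemma block_cyclic_support P : block_cyclic P ->
  forall x y, P x y != 0 -> tagnat.sig1 x = ordS (tagnat.sig1 y).
Proof.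
move=> cP x y; apply: contraNeq => /negPf xy.
have := cP (tagnat.sig1 x) (tagnat.sig1 y); rewrite xy.
move=> /matrixP/(_ (tagnat.sig2 x) (tagnat.sig2 y)).
by rewrite !mxE !tagnat.sig2K => ->.
Qed.

(** A row of [P] vanishes outside the one permitted block, so that block inherits the full row sum
    1. *)
Lemma support_block_cyclic P : stochastic P ->
  (forall x y, P x y != 0 -> tagnat.sig1 x = ordS (tagnat.sig1 y)) ->
  block_cyclic P.
Proof.
move=> sP supp i j; case: eqP => [ij|ij]; last first.
  apply/matrixP => a a'; rewrite !mxE; apply: contra_not_eq ij => /supp.
  by rewrite !tagnat.Rank1K.
split=> [a a'|]; first by rewrite mxE; case: sP => P0 _; apply: P0.
apply/matrixP => a k; rewrite !mxE -[RHS](stochastic_sum (tagnat.Rank i a) sP).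
rewrite [RHS](bigID (mem (block_states s j))) /= [X in _ + X]big1 => [|y].
  rewrite addr0 block_statesE big_imset /=; last by move=> ? ? _ _; apply: Rank_inj.
  by apply: eq_bigr => a' _; rewrite !mxE mulr1.
rewrite inE; apply: contraNeq => /supp; rewrite tagnat.Rank1K ij.
by move/(@ordS_inj d) => ->.
Qed.

Lemma dvdp_char_poly_block_cyclic P :
  block_cyclic P -> 'X^(n - d * s b1) %| char_poly P.
Proof.
move/block_cyclic_support/(dvdp_char_poly_cyclic hd).
by rewrite -[s b1]card_block_states.
Qed.

End Blocks.

(** * Ordering all cells along a single cycle *)

Section Position.
Variables (d r : nat) (hd : (2 <= d)%N).
Local Notation b1 := (block1 hd).

(* Position of the cell C^(j+1)_(l+1) along the cycle of all [d * r] cells: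
   the chain started in a cell always moves to the cell just before it. *)
Lemma position_subproof (j : 'I_d) (l : 'I_r) : (d * l + ord_pred j < d * r)%N.
Proof.
have := ltn_ord (ord_pred j); have := leq_mul (leqnn d) (ltn_ord l); lia.
Qed.

Definition position j l := Ordinal (position_subproof j l).

Lemma val_position j l : val (position j l) = (d * l + val (ord_pred j))%N.
Proof. by []. Qed.

Lemma position_inj j j' l l' :
  position j l = position j' l' -> j = j' /\ l = l'.
Proof.
have d0 : (0 < d)%N by apply: leq_trans hd.
move/(congr1 val) => /=; rewrite !(mulnC d) => E.
have := congr1 (modn^~ d) E; have := congr1 (divn^~ d) E.
rewrite !divnMDl // !divn_small ?ltn_pmod // !addn0 => /val_inj ->.
rewrite !modnMDl !modn_mod => jj; split=> //.
exact/(@ord_pred_inj d)/val_inj.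
Qed.

Lemma position_surj u : exists j, exists l, position j l = u.
Proof.
have d0 : (0 < d)%N by apply: leq_trans hd.
have lr : (u %/ d < r)%N by rewrite ltn_divLR // [(r * d)%N]mulnC.
exists (ordS (Ordinal (ltn_pmod u d0))), (Ordinal lr).
by apply: val_inj; rewrite val_position ordSK /= mulnC -divn_eq.
Qed.

(** The offset [ord_pred j] puts block 1 last in each group of [d] consecutive positions. The carry
    to the next group thus occurs exactly between block 1 and block 2, where the extremal matrix
    shifts the cell index. *)
Lemma ordS_position j l :
  ordS (position j l) = position (ordS j) (if j == b1 then ordS l else l).
Proof.
apply: val_inj; rewrite val_position ordSK /=.
case: (eqVneq j b1) => [->|jb1] /=.
  have -> : ((0 + d).-1 %% d = d.-1)%N by rewrite modn_small //; lia.
  have -> : ((d * l + d.-1).+1 = d * l.+1)%N by lia.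
  by rewrite -muln_modr addn0.
have j0 : (0 < j)%N by rewrite lt0n.
have jd := ltn_ord j.
have -> : ((j + d).-1 %% d = j.-1)%N.
  by rewrite (_ : (j + d).-1 = j.-1 + d)%N ?modnDr ?modn_small //; lia.
rewrite modn_small; first by lia.
have := leq_mul (leqnn d) (ltn_ord l); lia.
Qed.

End Position.

(** * The extremal matrix as a cyclic average *)

Section ExtremalForm.
Variables (R : realType) (d : nat) (hd : (2 <= d)%N) (s : 'I_d -> nat).
Local Notation n := (\sum_i s i)%N.
Local Notation b1 := (block1 hd).
Local Notation r := (s b1).
Hypothesis r_gt0 : (0 < r)%N.
Variables (C : 'I_d -> 'I_r -> {set 'I_n}) (P : 'M[R]_n).
Hypotheses (partC : block_partitions C) (extP : extremal_form hd C P).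

(** The default index is never returned, since the cells of a block cover it. *)
Definition cell (x : 'I_n) : 'I_r :=
  odflt (Ordinal r_gt0) [pick l | x \in C (tagnat.sig1 x) l].

Lemma mem_cell x j l : (x \in C j l) = (tagnat.sig1 x == j) && (cell x == l).
Proof.
have coverE i : cover [set C i l | l : 'I_r] = block_states s i.
  by have [_ /and3P[/eqP]] := partC i.
have trivC i : trivIset [set C i l | l : 'I_r].
  by have [_ /and3P[]] := partC i.
have blockC i k : x \in C i k -> tagnat.sig1 x = i.
  move=> xC; have : x \in block_states s i.
    by rewrite -coverE; apply/bigcupP; exists (C i k); rewrite ?imset_f.
  by rewrite inE => /eqP.
have cellC : x \in C (tagnat.sig1 x) (cell x).
  rewrite /cell; case: pickP => //= noC.
  have : x \in block_states s (tagnat.sig1 x) by rewrite inE.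
  by rewrite -coverE => /bigcupP[B /imsetP[k _ ->]]; have /= -> := noC k.
apply/idP/andP => [xC|[/eqP <- /eqP <-] //].
have xj := blockC _ _ xC; split; apply/eqP => //.
have [C_inj _] := partC j; apply: C_inj.
rewrite -xj in xC cellC *.
rewrite -(def_pblock (trivC _) (imset_f _ _) xC) //.
by rewrite (def_pblock (trivC _) (imset_f _ _) cellC).
Qed.

Lemma C_gt0 j l : (0 < #|C j l|)%N.
Proof.
have [_ /and3P[_ _ C0]] := partC j.
by rewrite card_gt0; apply: contraNneq C0 => <-; apply: imset_f.
Qed.

(** Block 1 has [r] states split into [r] nonempty cells, so this is the equality case of a sum of
    bounds 1 <= |C|. It makes the entry 1 of the third clause an average over a cell like the
    others. *)
Lemma card_C_block1 l : #|C b1 l| = 1%N.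
Proof.
have [C_inj Cpart] := partC b1; have := card_partition Cpart.
rewrite card_block_states big_imset /=; last by move=> ? ? _ _; apply: C_inj.
have leC k : (1 <= #|C b1 k| ?= iff (1 == #|C b1 k|))%N.
  exact/leqif_eq/C_gt0.
have [_ ] := leqif_sum (fun k (_ : predT k) => leC k).
rewrite sum_nat_const card_ord muln1 => + rE; rewrite -[X in _ == X]rE eqxx.
by move=> /esym/forall_inP/(_ l isT)/eqP.
Qed.

Definition cell_position x := position hd (tagnat.sig1 x) (cell x).

Lemma cell_position_eq x j l :
  (cell_position x == position hd j l) = (x \in C j l).
Proof.
rewrite mem_cell; apply/eqP/andP => [/position_inj[-> ->] //|].
by case=> /eqP <- /eqP <-.
Qed.

Lemma cell_position_surj u : exists x, cell_position x = u.
Proof.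
have [j [l <-]] := position_surj hd u.
have /card_gt0P[x xC] := C_gt0 j l.
by exists x; apply/eqP; rewrite cell_position_eq.
Qed.

Lemma card_fiber_cell_position j l :
  #|fiber cell_position (position hd j l)| = #|C j l|.
Proof. by apply: eq_card => x; rewrite inE cell_position_eq. Qed.

Lemma ord_pred_block1 : ord_pred b1 != b1.
Proof.
by rewrite -(inj_eq (@ordS_inj d)) ord_predK eq_sym ordS_neq.
Qed.

Lemma ord_pred_neq_block1 (j : 'I_d) : (2 <= j)%N -> ord_pred j != b1.
Proof.
move=> j2; rewrite -(inj_eq (@ordS_inj d)) ord_predK -val_eqE /=.
by rewrite modn_small // gtn_eqF.
Qed.

Lemma extremal_cyclic_average : P = cyclic_average cell_position R.
Proof.
apply/matrixP => x y; rewrite mxE /cell_position ordS_position.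
rewrite -/(cell_position y) card_fiber_cell_position.
have yC : y \in C (tagnat.sig1 y) (cell y) by rewrite mem_cell !eqxx.
have [case1 case2 case3 case0] := extP x y.
rewrite -/(cell_position x) cell_position_eq.
case: ifPn => [|xC].
  (* The block of [y] selects the clause: block 1 gives the third, the last block the first, and any
     other block the second. *)
  case: (eqVneq (tagnat.sig1 y) b1) => [yb1 xC|yb1 xC].
    rewrite yb1 in yC xC *; rewrite card_C_block1 invr1 (case3 (ordS (cell y))) //.
    by rewrite ordSK xC yC.
  have [j1|j1] := eqVneq (ordS (tagnat.sig1 y)) b1.
    have jE : tagnat.sig1 y = ord_pred b1 by rewrite -j1 ordSK.
    rewrite j1 in xC; rewrite jE in yC *.
    by rewrite (case1 (cell y)) // xC yC.
  (* The block of [x] has neither index 0, as [y] is not in the last block, nor index 1, as [y] is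
     not in block 1. *)
  have j2 : (2 <= ordS (tagnat.sig1 y))%N.
    move: j1; have : ordS (tagnat.sig1 y) != ordS b1.
      by rewrite (inj_eq (@ordS_inj d)).
    rewrite -!val_eqE /= [(1 %% d)%N]modn_small //.
    by case: (_ %% d)%N => [|[]].
  by rewrite (case2 (ordS (tagnat.sig1 y)) (cell y)) ?ordSK // j2 xC.
apply: case0 => [l|j l|l]; apply: contraNN xC.
- case/andP=> xC; rewrite mem_cell => /andP[/eqP -> /eqP ->].
  by rewrite (negPf ord_pred_block1) ord_predK.
- case/and3P=> j2 xC; rewrite mem_cell => /andP[/eqP -> /eqP ->].
  by rewrite (negPf (ord_pred_neq_block1 j2)) ord_predK.
- case/andP=> xC; rewrite mem_cell => /andP[/eqP -> /eqP ->].
  by rewrite eqxx ord_predK.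
Qed.

Lemma extremal_properties :
  [/\ stochastic P, irreducible P, periodic P, block_cyclic P
    & kemeny P = real_complex R (n%:R - (d * r + 1)%N%:R / 2)].
Proof.
have surj := cell_position_surj; have PE := extremal_cyclic_average.
have sP : stochastic P by rewrite PE; apply: cyclic_average_stochastic.
have m2 : (2 <= d * r)%N by apply: leq_trans hd _; rewrite leq_pmulr.
have cP : block_cyclic P.
  apply: support_block_cyclic => // x y; rewrite PE mxE.
  case: ifP => [/eqP|_]; last by rewrite eqxx.
  by rewrite /cell_position ordS_position => /position_inj[].
split=> //; rewrite ?PE.
- exact: cyclic_average_irreducible.
- exact: cyclic_average_periodic.
apply: cyclic_average_kemeny => //; first exact: ltnW.
by rewrite -PE; apply: dvdp_char_poly_block_cyclic.
Qed.

End ExtremalForm.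

Theorem corollary4p6 (R : realType) (d : nat) (hd : (2 <= d)%N)
    (s : 'I_d -> nat) (hpos : forall i, (0 < s i)%N)
    (hmin : forall i, (s (block1 hd) <= s i)%N) :
  (forall P : 'M[R]_(\sum_i s i),
     stochastic P -> irreducible P -> periodic P -> block_cyclic P ->
     real_complex R ((\sum_i s i)%N%:R - (d * s (block1 hd) + 1)%N%:R / 2)
       <= kemeny P)
  /\
  (forall (C : 'I_d -> 'I_(s (block1 hd)) -> {set 'I_(\sum_i s i)})
          (P : 'M[R]_(\sum_i s i)),
     block_partitions C -> extremal_form hd C P ->
     [/\ stochastic P, irreducible P, periodic P, block_cyclic P
       & kemeny P =
         real_complex R ((\sum_i s i)%N%:R
                         - (d * s (block1 hd) + 1)%N%:R / 2)]).
Proof.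
split=> [P sP iP _ cP|C P partC extP]; last exact: extremal_properties extP.
have n_gt0 : (0 < \sum_i s i)%N by rewrite (bigD1 (block1 hd)) //= addn_gt0 hpos.
apply: le_trans (kemeny_ge n_gt0 sP iP); rewrite lecR.
(* With k the multiplicity of 0, k >= n - d n_1 turns n - (n + 1) / 2 + k / 2 into at least n - (d
   n_1 + 1) / 2; [leq_subLR] first removes the truncated subtraction. *)
have := count_eigenvalues0 (dvdp_char_poly_block_cyclic hd cP).
rewrite leq_subLR -(ler_nat R) !natrD; lra.
Qed.
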